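(* Let $\Omega\subset\mathbb{R}^n$ be an embedded $n$-dimensional manifold (possibly with boundary) with triangulation $K$, let $X$ be a discrete vector field on $K$, let $0\le p\le n$, and let $\omega\in \mathrm{Im}(W)$, i.e. $\omega=W(c)$ for some simplicial $p$-cochain $c\in C^p(K)$. Then, with $\mathrm{d}_{\mathrm{Whitney}}=W\partial^{\mathrm{T}}R$, $$\mathcal{L}_X\, WR(\omega) \;=\; X\lrcorner\,(\mathrm{d}_{\mathrm{Whitney}}\,\omega)\;+\;\mathrm{d}\,\bigl(X\lrcorner\, WR(\omega)\bigr).$$
   Context: $K$ is a simplicial complex of affine simplices in $\mathbb{R}^n$ triangulating $\Omega$, with simplices oriented. $C^p(K)$ is the space of real-valued simplicial $p$-cochains, with the elementary cochain of an oriented $p$-simplex $\sigma$ again denoted $\sigma$. $\partial^{\mathrm{T}}:C^p(K)\to C^{p+1}(K)$ is the simplicial coboundary operator, i.e. the transpose of the simplicial boundary operator $\partial$. For a vertex $i$, $\mu_i$ denotes its barycentric coordinate: the continuous function, affine on every simplex, equal to $1$ at vertex $i$ and $0$ at all other vertices. $F^p(\Omega)$ denotes the differential $p$-forms on $\Omega$. Since Whitney forms are only piecewise smooth, forms here are understood as smooth on each closed simplex with matching tangential restrictions to common faces. The exterior derivative $\mathrm{d}$, the contraction $X\lrcorner$ and the Lie derivative $\mathcal{L}_X$ (the usual Lie derivative of differential forms along $X$) are computed on each $n$-simplex, and the identity in the claim is an identity of forms on each $n$-simplex. The Whitney map $W:C^p(K)\to F^p(\Omega)$ is the linear map given on a $p$-simplex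 $\sigma=\{i_0,\dots,i_p\}$ by $$W\sigma=p!\sum_{k=0}^p(-1)^k\mu_{i_k}\,\mathrm{d}\mu_{i_0}\wedge\dots\wedge\widehat{\mathrm{d}\mu_{i_k}}\wedge\dots\wedge \mathrm{d}\mu_{i_p}\quad(p>0),\qquad W\sigma=\mu_{i_0}\quad(p=0),$$ where the hat denotes omission. The de Rham map $R:F^p(\Omega)\to C^p(K)$ sends $\eta$ to the cochain whose value on a simplicial $p$-chain $c$ is $\int_c\eta$. $\mathrm{d}_{\mathrm{Whitney}}=W\partial^{\mathrm{T}}R$ maps $p$-forms to $(p+1)$-forms. A discrete vector field on $K$ is an infinitesimal piecewise-linear diffeomorphism induced by a 1-parameter deformation of the vertices: if vertex $i$ moves along a smooth curve $x_i(t)\in\mathbb{R}^n$ with barycentric coordinates carried along, then $X$ is the velocity field at $t=0$, i.e. the continuous vector field, affine on each simplex, given by $X=\sum_i\mu_i\,\frac{\mathrm{d}x_i}{\mathrm{d}t}(0)$. *)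

(* Defs.v *)
From HB Require Import structures.
From mathcomp Require Import all_boot all_order all_algebra finmap.
From mathcomp Require Import all_classical all_reals all_analysis.
Set Implicit Arguments.
Unset Strict Implicit.
Unset Printing Implicit Defensive.
Import Order.TTheory GRing.Theory Num.Theory.
Import numFieldNormedType.Exports.
Local Open Scope classical_set_scope.
Local Open Scope ring_scope.

Section Complexes.
Variables (R : realType) (n : nat).
Local Notation V := 'rV[R]_n.

Definition affinely_independent (s : {fset V}) : Prop :=
  forall w : V -> R, \sum_(u <- s) w u = 0 -> \sum_(u <- s) w u *: u = 0 ->
  forall u, u \in s -> w u = 0.

(* The closed affine simplex spanned by [s]; it is empty for [s = fset0]. *)
Definition hull (s : {fset V}) : set V :=
  [set x | exists w : V -> R, [/\ forall u, 0 <= w u,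
     \sum_(u <- s) w u = 1 & \sum_(u <- s) w u *: u = x]].

(* [vord s] lists the vertices of [s] in an order that represents the chosen
   orientation of [s]. *)
Record oriented_complex := OrientedComplex {
  faces : set {fset V};
  vord : {fset V} -> seq V }.

Implicit Type K : oriented_complex.

Definition polyhedron K : set V := \bigcup_(s in faces K) hull s.

(* Complexes may be infinite, but are locally finite. *)
Record is_oriented_complex K : Prop := IsOrientedComplex {
  face_neq0 : forall s, faces K s -> s != fset0;
  face_affine : forall s, faces K s -> affinely_independent s;
  face_closed : forall s t : {fset V},
    faces K s -> (t `<=` s)%fset -> t != fset0 -> faces K t;
  face_meet : forall s t, faces K s -> faces K t ->
    hull s `&` hull t = hull (s `&` t)%fset;
  face_locfin : forall x, polyhedron K x -> exists U : set V,
    [/\ open U, U x & finite_set [set s | faces K s /\ hull s `&` U !=set0]];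
  vord_perm : forall s, faces K s -> perm_eq (vord K s) (enum_fset s) }.

Definition simplices K p : set {fset V} := [set s | faces K s /\ #|` s| = p.+1].

Definition vertices K : set V := [set i | faces K [fset i]%fset].

(* For [n = 0] this is the whole one-point space. *)
Definition half_space : set V :=
  [set y | forall i : 'I_n, i = 0%N :> nat -> 0 <= y 0 i].

(* [Om], with the subspace topology, is an [n]-manifold, possibly with boundary:
   every point has a neighbourhood [Om `&` U] with a homeomorphism [f], of
   inverse [g], onto a relatively open subset of the closed half-space. *)
Definition manifold_with_boundary (Om : set V) : Prop :=
  forall x, Om x -> exists (U O : set V) (f g : V -> V),
    [/\ open U /\ U x,
        open O /\ f @` (Om `&` U) = O `&` half_space,
        forall y, (Om `&` U) y -> g (f y) = y,
        {within Om `&` U, continuous f} &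
        {within O `&` half_space, continuous g}].

Definition triangulates K (Om : set V) : Prop := polyhedron K = Om.

(* A cochain is given by its values on the simplices with their chosen
   orientation; a [p]-cochain is only ever used on [simplices K p]. *)
Definition cochain := {fset V} -> R.

(* Sign of the permutation relating two orderings of the same vertices, as the
   determinant of its permutation matrix. *)
Definition ord_sign (s t : seq V) : R :=
  \det (\matrix_(i < size s, j < size s) (nth 0 s i == nth 0 t j)%:R).

(* Coefficient of the oriented simplex [t] in the boundary
   \sum_k (-1)^k [i_0, .., ^i_k, .., i_p] of the oriented simplex [s]. *)
Definition boundary_coef K (s t : {fset V}) : R :=
  \sum_(v <- vord K s | t == (s `\ v)%fset)
     (-1) ^+ index v (vord K s) * ord_sign (rem v (vord K s)) (vord K t).

(* Transpose of the matrix of the boundary operator; the sum has finite support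
   since a simplex has finitely many faces. *)
Definition coboundary K p (c : cochain) : cochain :=
  fun s => \sum_(t \in simplices K p) boundary_coef K s t * c t.

End Complexes.

Section Forms.
Variables (R : realType) (n : nat).
Local Notation V := 'rV[R]_n.

(* A [p]-form takes a point and [p] vectors, the rows of a matrix. Neither
   smoothness nor multilinearity nor alternation is imposed: the operators below
   are given by formulas that are total, and are applied to Whitney forms. *)
Definition form p := V -> 'M[R]_(p, n) -> R.

(* d w (v_0, .., v_p) = \sum_i (-1)^i D_(v_i) (w (v_0, .., ^v_i, .., v_p)), the
   v_i being constant vector fields. *)
Definition ext_d p (w : form p) : form p.+1 := fun x M =>
  \sum_(i < p.+1) (-1) ^+ i * 'D_(row i M) (fun y => w y (row' i M)) x.

Definition interior_prod p (X : V -> V) (w : form p.+1) : form p :=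
  fun x M => w x (col_mx (X x) M : 'M[R]_(1 + p, n)).

(* d (X _| w); the contraction of a 0-form is 0. *)
Definition d_interior_prod p (X : V -> V) : form p -> form p :=
  match p with
  | 0 => fun _ _ _ => 0
  | q.+1 => fun w => ext_d (interior_prod X w)
  end.

Definition is_flow (X : V -> V) (phi : R -> V -> V) : Prop :=
  forall x, phi 0 x = x /\
    forall t : R, is_derive t 1 (fun s => phi s x) (X (phi t x)).

(* The flow of a complete vector field; affine vector fields are complete. *)
Definition flow (X : V -> V) : R -> V -> V :=
  xget ((fun _ x => x) : R -> V -> V) [set phi | is_flow X phi].

Definition pullback p (phi : V -> V) (w : form p) : form p :=
  fun x M => w (phi x) (\matrix_(j < p) 'D_(row j M) phi x).

Definition lie_derivative p (X : V -> V) (w : form p) : form p :=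
  fun x M => derive1 (fun t : R => pullback (flow X t) w x M) 0.

(* Integral over the simplex { t_j >= 0, \sum_j t_j <= a } of R^p, as an
   iterated Lebesgue integral. *)
Fixpoint int_simplex p (a : R) : ('rV[R]_p -> R) -> R :=
  match p with
  | 0 => fun f => f 0
  | q.+1 => fun f => \int[lebesgue_measure]_(t in `[0, a])
      int_simplex (a - t) (fun y => f (row_mx t%:M y : 'rV[R]_(1 + q)))
  end.

(* Integral of a [p]-form over the affine simplex with ordered vertices [s],
   parametrized by t |-> s_0 + \sum_j t_j (s_(j+1) - s_0). *)
Definition int_form p (s : seq V) (w : form p) : R :=
  let E : 'M[R]_(p, n) := \matrix_(j < p) (nth 0 s j.+1 - nth 0 s 0) in
  int_simplex 1 (fun t => w (nth 0 s 0 + t *m E) E).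

End Forms.

Section Whitney.
Variables (R : realType) (n : nat).
Local Notation V := 'rV[R]_n.
Implicit Type K : oriented_complex R n.

(* The restriction to the simplex [T] of the barycentric coordinate of the
   vertex [i], extended affinely to the affine hull of [T]. It vanishes if [i]
   is not a vertex of [T]. Off the affine hull the value is irrelevant: there
   are no such points if [T] is an [n]-simplex. *)
Definition bary (T : {fset V}) (i x : V) : R :=
  xget ((fun _ => 0) : V -> R)
    [set w : V -> R | [/\ forall u, u \notin T -> w u = 0,
     \sum_(u <- T) w u = 1 & \sum_(u <- T) w u *: u = x]] i.

(* Piecewise smooth forms and fields are families indexed by the simplices of
   the complex. The member at [T] is a form on the closed simplex [T], given by
   a smooth extension to the affine hull of [T]; only points of that hull and
   vectors tangent to it matter. *)
Definition pw_form p := {fset V} -> form R n p.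
Definition pw_field := {fset V} -> V -> V.

(* The Whitney form of the simplex with ordered vertices [s]. The wedge product
   of 1-forms a_1, .., a_p takes v_1, .., v_p to \det (a_i v_j). *)
Definition whitney_simplex p (s : seq V) : pw_form p := fun T x M =>
  p`!%:R * \sum_(k < p.+1) (-1) ^+ k * bary T (nth 0 s k) x *
    \det (\matrix_(i < p, j < p)
            'D_(row j M) (bary T (nth 0 s (lift k i))) x).

(* On a given [T] only the faces of [T] contribute, so that the sum has finite
   support even if the complex is infinite. *)
Definition whitney K p (c : cochain R n) : pw_form p := fun T x M =>
  \sum_(s \in simplices K p) c s * whitney_simplex (vord K s) T x M.

Definition de_rham K p (w : pw_form p) : cochain R n :=
  fun s => int_form (vord K s) (w s).

Definition d_whitney K p (w : pw_form p) : pw_form p.+1 :=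
  whitney K (coboundary K p (de_rham K w)).

Definition smooth_curve (c : R -> V) : Prop :=
  forall k (t : R), derivable (derive1n k c) t 1.

Definition discrete_field K (X : pw_field) : Prop :=
  exists c : V -> R -> V,
    (forall i, vertices K i -> smooth_curve (c i) /\ c i 0 = i) /\
    forall T, faces K T -> forall x,
      X T x = \sum_(i \in vertices K) bary T i x *: derive1 (c i) 0.

End Whitney.

Arguments whitney {R n} K p c.
Arguments de_rham {R n} K {p} w.
Arguments d_whitney {R n} K {p} w.

(* Main.v *)
Require Import Defs.
From HB Require Import structures.
From mathcomp Require Import all_boot all_order all_algebra finmap.
From mathcomp Require Import all_classical all_reals all_analysis.
From mathcomp Require Import ring.
Set Implicit Arguments.
Unset Strict Implicit.
Unset Printing Implicit Defensive.
Import Order.TTheory GRing.Theory Num.Theory.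
Import numFieldNormedType.Exports.
Local Open Scope classical_set_scope.
Local Open Scope ring_scope.

(** The maps W and R satisfy R W = id on cochains, so WR fixes the form
    w = W c, and the Whitney derivative of w is W of the coboundary of c.  The
    Whitney map is a cochain map, d (W c) = W (coboundary c), hence the Whitney
    derivative of w is its exterior derivative on every n-simplex, and the
    claim becomes Cartan's formula for the Lie derivative of w along X.

    Everything reduces to determinants.  On an n-simplex T the barycentric
    coordinates are affine functions, so the Whitney form of a p-simplex with
    vertices s_0, .., s_p is p! times a determinant: row i holds the value of
    mu_(s_i) at x and its derivatives along the p argument vectors
    ([whitney_simplexE]).

    - [de_rham_whitney]: on the simplex s itself and its edge vectors this
      determinant is 1, and the parameter simplex has volume 1/p!; the Whitney
      form of another p-simplex t vanishes on s, as s misses a vertex of t.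
    - [ext_d_whitney]: the determinant is alternating in the vertices, so the
      incidence numbers turn the form of a coface u = {v} + t of t into the form
      of the ordered simplex (v, t).  Summing over all vertices v of T replaces
      the first row by (sum mu_v, sum d mu_v) = (1, 0), which leaves
      (p+1)! d mu_(t_0) /\ .. /\ d mu_(t_p), the exterior derivative of the form
      of t.
    - [cartan_det_forms]: the velocity field X is affine on T, so its flow
      exists for all times and is affine, with the matrix exponential as linear
      part.  The three terms of Cartan's formula are then derivatives at 0 of
      determinants in one real variable, that is, sums of determinants with one
      row replaced by its derivative ([is_derive_det]), and they are compared by
      moving rows. *)

(** * Derivatives of matrix-valued maps and of determinants *)

Section Derivatives.
Variable R : realType.

(** Reduces directional derivatives to derivatives in one real variable, where
    product rules are available for every kind of matrix expression. *)
Lemma is_derive_line (U W : normedModType R) (f : U -> W) (x v : U) (d : W) :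
  is_derive (0 : R) 1 (fun h : R => f (h *: v + x)) d -> is_derive x v f d.
Proof.
have E : (fun h : R => h^-1 *: ((f \o shift x) (h *: v) - f x)) =
   (fun h : R => h^-1 *: (((fun k : R => f (k *: v + x)) \o shift 0) (h *: 1)
      - f (0 *: v + x))).
  by apply/funext => h /=; rewrite addr0 scale0r add0r /GRing.scale /= mulr1.
case=> [df dE]; split; first by rewrite /derivable E.
by rewrite /derive E.
Qed.

Lemma is_derive_affine (U W : normedModType R) (f : U -> W) (x v : U) (d : W) :
  (forall h : R, f (h *: v + x) = f x + h *: d) -> is_derive x v f d.
Proof.
move=> fE.
have : (fun h : R => h^-1 *: ((f \o shift x) (h *: v) - f x)) @ 0^' --> d.
  apply: cvg_near_cst; near=> h => /=.
  rewrite fE addrC addKr scalerA mulVf ?scale1r //.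
  by near: h; exact: nbhs_dnbhs_neq.
move=> H; apply: DeriveDef; last exact/cvg_lim.
by apply/cvg_ex; exists d.
Unshelve. all: by end_near. Qed.

Lemma is_derive_mul (f g : R -> R) (x df dg : R) :
  is_derive x 1 f df -> is_derive x 1 g dg ->
  is_derive x 1 (fun t => f t * g t) (df * g x + f x * dg).
Proof.
move=> Hf Hg; apply: (is_derive_eq (is_deriveM Hf Hg)).
by rewrite addrC mulrC.
Qed.

Lemma is_derive_bigsum (U W : normedModType R) (I : Type) (r : seq I)
    (P : pred I) (f : I -> U -> W) (df : I -> W) (x v : U) :
  (forall i, P i -> is_derive x v (f i) (df i)) ->
  is_derive x v (fun t => \sum_(i <- r | P i) f i t)
    (\sum_(i <- r | P i) df i).
Proof.
move=> Hf; elim: r => [|i r IH].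
  rewrite big_nil (_ : (fun _ => _) = cst 0); first exact: is_derive_cst.
  by apply/funext => t; rewrite big_nil.
rewrite big_cons; case: ifP => Pi.
  rewrite (_ : (fun _ => _) = f i + (fun t => \sum_(i <- r | P i) f i t)).
    by apply: is_deriveD => //; exact: Hf.
  by apply/funext => t; rewrite big_cons Pi.
by rewrite (_ : (fun _ => _) = (fun t => \sum_(i <- r | P i) f i t)) //;
  apply/funext => t; rewrite big_cons Pi.
Qed.

Lemma is_derive_mxP m n (U : normedModType R) (M : U -> 'M[R]_(m, n)) x v D :
  is_derive x v M D <->
  forall i j, is_derive x v (fun t => M t i j) (D i j).
Proof.
split=> [[dM ME] i j|HM].
  have [/(_ dM) H _] := derivable_mxP M x v; apply: DeriveDef; first exact: H.
  by rewrite -ME derive_mx // mxE.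
have dM : derivable M x v.
  by apply/derivable_mxP => i j; apply: ex_derive; exact: HM.
apply: DeriveDef => //; rewrite derive_mx //; apply/matrixP => i j.
by rewrite mxE; apply: derive_val; exact: HM.
Qed.

Definition replace_row m n (i : 'I_m) (N M : 'M[R]_(m, n)) : 'M[R]_(m, n) :=
  \matrix_(k, j) (if k == i then N k j else M k j).

(** The determinant is linear in each row, so its derivative is a sum over the
    rows; by induction on the size, through the Laplace expansion along row 0,
    whose cofactors are determinants of smaller matrices. *)
Lemma is_derive_det m (B : R -> 'M[R]_m) (B' : 'M[R]_m) (t : R) :
  is_derive t 1 B B' ->
  is_derive t 1 (fun s => \det (B s)) (\sum_i \det (replace_row i B' (B t))).
Proof.
move=> /is_derive_mxP; elim: m B B' => [|m IH] B B' HB.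
  rewrite big_ord0 (_ : (fun _ => _) = cst 1); first exact: is_derive_cst.
  by apply/funext => s; rewrite det_mx00.
rewrite (_ : (fun _ => _) = fun s => \sum_j B s ord0 j * ((-1) ^+ j *
    \det (row' ord0 (col' j (B s))))); last first.
  apply/funext => s; rewrite (expand_det_row _ ord0); apply: eq_bigr => j _.
  by rewrite /cofactor add0n.
have -> : \sum_i \det (replace_row i B' (B t)) =
  \sum_j (B' ord0 j * ((-1) ^+ j * \det (row' ord0 (col' j (B t)))) +
          B t ord0 j * ((-1) ^+ j *
   \sum_i \det (replace_row i (row' ord0 (col' j B'))
                              (row' ord0 (col' j (B t)))))).
  rewrite big_ord_recl big_split /=; congr (_ + _).
    rewrite (expand_det_row _ ord0); apply: eq_bigr => j _.
    rewrite mxE eqxx /cofactor add0n; congr (_ * (_ * \det _)).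
    by apply/matrixP => k l; rewrite !mxE.
  under [RHS]eq_bigr do rewrite !mulr_sumr.
  rewrite [RHS]exchange_big /=; apply: eq_bigr => i _.
  rewrite (expand_det_row _ ord0); apply: eq_bigr => j _.
  rewrite mxE /cofactor add0n; congr (_ * (_ * \det _)).
  by apply/matrixP => k l; rewrite !mxE (inj_eq lift_inj).
apply: is_derive_bigsum => j _.
apply: is_derive_mul.
(* The constant sign is treated as a factor with derivative 0. *)
rewrite -[X in is_derive _ _ _ X]add0r -[X in is_derive _ _ _ (X + _)](mul0r
  (\det (row' ord0 (col' j (B t))))).
apply: (@is_derive_mul (cst _)).
apply: IH => i k.
rewrite (_ : (fun _ => _) = fun s => B s (lift ord0 i) (lift j k)).
  by rewrite !mxE; apply: HB.
by apply/funext => s; rewrite !mxE.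
Qed.

End Derivatives.

(** * The matrix exponential and linear differential equations *)

Section LinearODE.
Variable R : realType.

Lemma is_derive_mulmx m n p (Y : R -> 'M[R]_(m, n)) (Z : R -> 'M[R]_(n, p))
    (t : R) Y' Z' :
  is_derive t 1 Y Y' -> is_derive t 1 Z Z' ->
  is_derive t 1 (fun s => Y s *m Z s) (Y' *m Z t + Y t *m Z').
Proof.
move=> /is_derive_mxP HY /is_derive_mxP HZ; apply/is_derive_mxP => i j.
rewrite (_ : (fun _ => _) = fun s => \sum_k Y s i k * Z s k j); last first.
  by apply/funext => s; rewrite mxE.
rewrite !mxE -big_split /=.
by apply: is_derive_bigsum => k _; apply: is_derive_mul.
Qed.

Lemma constant_of_is_derive_mx0 m n (Y : R -> 'M[R]_(m, n)) :
  (forall t : R, is_derive t 1 Y 0) -> forall t, Y t = Y 0.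
Proof.
move=> HY t; apply/matrixP => i j.
apply: (@is_derive_0_is_cst _ (fun s => Y s i j)) => s.
by have /is_derive_mxP /(_ i j) := HY s; rewrite mxE.
Qed.

Lemma is_derive_oppr m n (Y : R -> 'M[R]_(m, n)) (t : R) Y' :
  is_derive (- t) 1 Y Y' -> is_derive t 1 (fun s => Y (- s)) (- Y').
Proof.
move=> /is_derive_mxP HY; apply/is_derive_mxP => i j; rewrite mxE -mulrN1.
exact: (@is_derive1_comp _ (fun s => Y s i j) -%R t).
Qed.

Variables (n : nat) (A : 'M[R]_n).

(* A common bound for the absolute column sums of A; being at least 1, it
   makes the powers b ^+ k increasing. *)
Let b := 1 + \sum_i \sum_j `|A i j|.

Let col_le j : \sum_i `|A i j| <= b.
Proof.
rewrite ler_wpDl // ler_sum // => i _.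
by rewrite (bigD1 j) //= lerDl sumr_ge0.
Qed.

Let b_ge1 : 1 <= b.
Proof. by rewrite lerDl sumr_ge0 // => i _; rewrite sumr_ge0. Qed.

Let b_ge0 : 0 <= b. Proof. exact: le_trans b_ge1. Qed.

Lemma mx_exp_bound k i j : `|(A ^+ k) i j| <= b ^+ k.
Proof.
elim: k i j => [|k IH] i j.
  by rewrite !expr0 mxE; case: eqP => _; rewrite ?normr0 ?normr1.
rewrite !exprSr mxE (le_trans (ler_norm_sum _ _ _)) //.
apply: (@le_trans _ _ (\sum_l b ^+ k * `|A l j|)).
  by apply: ler_sum => l _; rewrite normrM ler_wpM2r.
by rewrite -mulr_sumr ler_wpM2l // exprn_ge0.
Qed.

(** Comparison with the series of C * exp (b |x|). *)
Lemma is_cvg_pseries_exp_bounded (c : R^nat) (C x : R) :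
  (forall k, `|c k| <= C * (b ^+ k / k`!%:R)) -> cvgn (pseries c x).
Proof.
move=> Hc; apply: normed_cvg.
have C0 : 0 <= C by move: (Hc 0%N); rewrite expr0 fact0 divr1 mulr1; exact: le_trans.
apply: (@series_le_cvg _ _ (C *: exp_coeff (b * `|x|))) => [k|k|k|].
- exact: normr_ge0.
- by rewrite mulr_ge0 // exp_coeff_ge0 // mulr_ge0.
- have -> : (C *: exp_coeff (b * `|x|)) k = C * (b ^+ k / k`!%:R) * `|x| ^+ k.
    by rewrite /GRing.scale /= /GRing.scale /= /exp_coeff /= exprMn mulrAC !mulrA.
  by rewrite /= normrM normrX ler_wpM2r ?exprn_ge0.
- by apply: is_cvg_seriesZ; exact: is_cvg_series_exp_coeff.
Qed.

Definition mx_series (c : nat -> 'M[R]_n) (t : R) : 'M[R]_n :=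
  \matrix_(i, j) limn (pseries (fun k => c k i j) t).

Definition exp_coef k : 'M[R]_n := (k`!%:R)^-1 *: A ^+ k.
(** Coefficients of the integral of the exponential from 0 to t, which solves
    the inhomogeneous equation G' = G A + 1 even when A is singular. *)
Definition expint_coef k : 'M[R]_n :=
  if k is l.+1 then (k`!%:R)^-1 *: A ^+ l else 0.

Definition mx_expint := mx_series expint_coef.
Definition mx_exp := mx_series exp_coef.

Lemma cvg_exp_coef (B : 'M[R]_n) i j x :
  cvgn (pseries (fun k => (B *m exp_coef k) i j) x).
Proof.
apply: (@is_cvg_pseries_exp_bounded _ (\sum_l `|B i l|)) => k.
rewrite mxE (le_trans (ler_norm_sum _ _ _)) // mulr_suml; apply: ler_sum => l _.
rewrite normrM ler_wpM2l // mxE normrM mulrC.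
rewrite [X in _ * X]ger0_norm ?invr_ge0 //.
by rewrite ler_wpM2r ?invr_ge0 // mx_exp_bound.
Qed.

Lemma mx_series0 c : mx_series c 0 = c 0%N.
Proof.
apply/matrixP => i j; rewrite mxE; apply/cvg_lim => //.
have H k : (0 < k)%N -> pseries (fun k => c k i j) 0 k = c 0%N i j.
  case: k => // k _; rewrite /pseries /series /= big_mkord big_ord_recl /=.
  rewrite expr0 mulr1 big1 ?addr0 // => l _.
  by rewrite expr0n /= mulr0.
apply: cvg_near_cst; near=> k.
by apply: H; near: k; exact: nbhs_infty_gt.
Unshelve. all: by end_near. Qed.

Lemma lim_pseries_mulmx (B : 'M[R]_n) i j x :
  limn (pseries (fun k => (B *m exp_coef k) i j) x) = (B *m mx_exp x) i j.
Proof.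
apply/cvg_lim => //; rewrite mxE.
rewrite (_ : pseries _ x = fun k => \sum_l B i l *
   pseries (fun k => (exp_coef k) l j) x k); last first.
  apply/funext => k; rewrite /pseries /series /=.
  under eq_bigr do rewrite mxE mulr_suml.
  rewrite exchange_big; apply: eq_bigr => l _; rewrite mulr_sumr.
  by apply: eq_bigr => ? _; rewrite mulrA.
apply: cvg_big => [|l _]; first exact: add_continuous.
apply: cvgMr; rewrite mxE.
have := @cvg_exp_coef 1 l j x.
by under eq_fun do rewrite mul1mx.
Qed.

Lemma diffs_exp_coef (B : 'M[R]_n) i j :
  pseries_diffs (fun k => (B *m exp_coef k) i j) =
  (fun k => (B *m A *m exp_coef k) i j).
Proof.
have Z a (N : 'M[R]_n) : (a *: N) i j = a * N i j by rewrite mxE.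
apply/funext => k; rewrite /pseries_diffs /exp_coef -!scalemxAr !Z.
rewrite factS natrM invfM !mulrA mulfV ?mul1r ?pnatr_eq0 //.
by rewrite exprS -[A * _]/(A *m _) mulmxA.
Qed.

Lemma is_derive_mx_exp (t : R) : is_derive t 1 mx_exp (A *m mx_exp t).
Proof.
apply/is_derive_mxP => i j.
rewrite -lim_pseries_mulmx -(mul1mx A) -diffs_exp_coef.
rewrite (_ : (fun _ => _) = fun x => limn (pseries (fun k => (1%:M *m exp_coef k) i j) x)).
  apply: (@pseries_snd_diffs _ _ (`|t| + 1)); rewrite ?diffs_exp_coef;
    try exact: cvg_exp_coef.
  by rewrite [ltRHS]ger0_norm ?addr_ge0 // ltrDl.
by apply/funext => x; rewrite mxE; under [in RHS]eq_fun do rewrite mul1mx.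
Qed.

Lemma is_derive_mx_expint (t : R) : is_derive t 1 mx_expint (mx_exp t).
Proof.
apply/is_derive_mxP => i j.
have D : pseries_diffs (fun k => expint_coef k i j) =
   (fun k => (1%:M *m exp_coef k) i j).
  apply/funext => k; rewrite /pseries_diffs mul1mx !mxE.
  by rewrite factS natrM invfM !mulrA mulfV ?mul1r ?pnatr_eq0.
have -> : mx_exp t i j = limn (pseries (pseries_diffs (fun k => expint_coef k i j)) t).
  by rewrite D lim_pseries_mulmx mul1mx.
have C x : cvgn (pseries (fun k => expint_coef k i j) x).
  apply: (@is_cvg_pseries_exp_bounded _ 1) => -[|k]; rewrite /= mxE.
    by rewrite normr0 mul1r divr_ge0 // exprn_ge0.
  rewrite normrM mul1r mulrC [X in _ * X]ger0_norm ?invr_ge0 //.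
  rewrite ler_wpM2r ?invr_ge0 // (le_trans (mx_exp_bound _ _ _)) //.
  by rewrite ler_weXn2l.
rewrite (_ : (fun _ => _) = fun x => limn (pseries (fun k => expint_coef k i j) x)).
  apply: (@pseries_snd_diffs _ _ (`|t| + 1)).
  - exact: C.
  - by rewrite D; exact: cvg_exp_coef.
  - by rewrite D diffs_exp_coef; exact: cvg_exp_coef.
  - by rewrite [ltRHS]ger0_norm ?addr_ge0 // ltrDl.
by apply/funext => x; rewrite mxE.
Qed.

(** The derivative of the exponential comes with A on the left; solutions
    y' = y A in row vectors need it on the right. *)
Lemma mx_exp_comm t : mx_exp t *m A = A *m mx_exp t.
Proof.
apply/matrixP => i j; rewrite -lim_pseries_mulmx.
have -> : (fun k => (A *m exp_coef k) i j) = (fun k => (exp_coef k *m A) i j).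
  apply/funext => k; rewrite /exp_coef -scalemxAr -scalemxAl.
  by rewrite -[A *m _]/(A * _) -exprS exprSr.
apply/esym/cvg_lim => //; rewrite mxE.
rewrite (_ : pseries _ t = fun k => \sum_l
   pseries (fun k => exp_coef k i l) t k * A l j); last first.
  apply/funext => k; rewrite /pseries /series /=.
  under eq_bigr do rewrite mxE mulr_suml.
  rewrite exchange_big; apply: eq_bigr => l _; rewrite mulr_suml.
  by apply: eq_bigr => ? _; rewrite mulrAC.
apply: cvg_big => [|l _]; first exact: add_continuous.
apply: cvgMl; rewrite mxE.
have := @cvg_exp_coef 1 i l t.
by under eq_fun do rewrite mul1mx.
Qed.

Lemma mx_exp0 : mx_exp 0 = 1%:M.
Proof. by rewrite /mx_exp mx_series0 /exp_coef fact0 invr1 scale1r expr0. Qed.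

Lemma mx_expint0 : mx_expint 0 = 0.
Proof. exact: mx_series0. Qed.

(** Both sides agree at 0 and have the same derivative. *)
Lemma mx_exp_expint t : mx_exp t = mx_expint t *m A + 1%:M.
Proof.
have D (s : R) : is_derive s 1 (fun t => mx_exp t - mx_expint t *m A) 0.
  apply: (is_derive_eq (is_deriveB (is_derive_mx_exp s)
    (is_derive_mulmx (is_derive_mx_expint s) (is_derive_cst A s 1)))).
  by rewrite mulmx0 addr0 mx_exp_comm subrr.
have := constant_of_is_derive_mx0 D t.
by rewrite mx_exp0 mx_expint0 mul0mx subr0 => <-; rewrite addrCA subrr addr0.
Qed.

Lemma mx_expNK t : mx_exp (- t) *m mx_exp t = 1%:M.
Proof.
have D (s : R) : is_derive s 1 (fun t => mx_exp (- t) *m mx_exp t) 0.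
  apply: (is_derive_eq (is_derive_mulmx (is_derive_oppr (is_derive_mx_exp (- s)))
    (is_derive_mx_exp s))).
  by rewrite -mx_exp_comm mulNmx mulmxA addNr.
by have := constant_of_is_derive_mx0 D t; rewrite oppr0 mx_exp0 mul1mx.
Qed.

(** y(t) exp(-tA) has derivative 0. *)
Lemma linear_ode_unique m (y : R -> 'M[R]_(m, n)) :
  (forall t : R, is_derive t 1 y (y t *m A)) ->
  forall t, y t = y 0 *m mx_exp t.
Proof.
move=> Hy t.
have D (s : R) : is_derive s 1 (fun t => y t *m mx_exp (- t)) 0.
  apply: (is_derive_eq (is_derive_mulmx (Hy s) (is_derive_oppr (is_derive_mx_exp (- s))))).
  by rewrite mulmxN mulmxA subrr.
have := constant_of_is_derive_mx0 D t.
rewrite oppr0 mx_exp0 mulmx1 => <-.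
by rewrite -mulmxA mx_expNK mulmx1.
Qed.

End LinearODE.

(** * The flow of an affine vector field *)

Section AffineFlow.
Variables (R : realType) (n : nat) (A : 'M[R]_n) (b : 'rV[R]_n).
Let X (x : 'rV[R]_n) := b + x *m A.

(** The displacement z = phi_t(x) - x solves z' = z A + X(x) with z(0) = 0,
    hence z is X(x) times the integral of the exponential. *)
Lemma affine_is_flow : is_flow X (flow X).
Proof.
apply: (@xgetPex _ _ [set phi | is_flow X phi]).
exists (fun t x => x + X x *m mx_expint A t) => x; split=> [|t].
  by rewrite mx_expint0 mulmx0 addr0.
apply: (is_derive_eq (is_deriveD (is_derive_cst x t 1)
   (is_derive_mulmx (is_derive_cst (X x) t 1) (is_derive_mx_expint A t)))).
rewrite mul0mx !add0r mx_exp_expint /X.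
by rewrite mulmxDr mulmx1 [(x + _) *m A]mulmxDl mulmxA addrC addrA.
Qed.

Lemma affine_flow0 x : flow X 0 x = x.
Proof. by have [] := affine_is_flow x. Qed.

Lemma is_derive_affine_flow (t : R) x :
  is_derive t 1 (fun s => flow X s x) (X (flow X t x)).
Proof. by have [_] := affine_is_flow x. Qed.

(** The difference of two trajectories of an affine field solves the
    homogeneous equation; uniqueness makes any flow of X affine, whichever one
    the choice operator selects. *)
Lemma affine_flowB x y t :
  flow X t x - flow X t y = (x - y) *m mx_exp A t.
Proof.
have D (s : R) : is_derive s 1 (fun t => flow X t x - flow X t y)
    ((flow X s x - flow X s y) *m A).
  apply: (is_derive_eq (is_deriveB (is_derive_affine_flow s x)
    (is_derive_affine_flow s y))).
  by rewrite /X opprD addrACA subrr add0r mulmxBl.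
by rewrite (linear_ode_unique D t) !affine_flow0.
Qed.

Lemma derive_affine_flow t x v : 'D_v (flow X t) x = v *m mx_exp A t.
Proof.
apply: derive_val; apply: is_derive_affine => h.
by apply/eqP; rewrite (addrC (flow X t x)) -subr_eq affine_flowB addrK scalemxAl.
Qed.

End AffineFlow.

(** * Moving rows in determinants *)

Section RowMoves.
Variable R : comPzRingType.

(** Cycling row i to the front composes i transpositions; here both
    determinants are expanded along that row. *)
Lemma det_move_row p (B : 'M[R]_p.+1) (i : 'I_p.+1) :
  \det (col_mx (row i B) (row' i B) : 'M[R]_(1 + p)) = (-1) ^+ i * \det B.
Proof.
rewrite (expand_det_row _ (lshift p ord0)) (expand_det_row B i) mulr_sumr.
apply: eq_bigr => j _; rewrite col_mxEu mxE /cofactor.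
rewrite add0n [RHS]mulrCA exprD -mulrA signrMK; congr (_ * (_ * \det _)).
apply/matrixP => k l; rewrite !mxE.
have -> : lift (lshift p ord0) k = rshift 1 k :> 'I_(1 + p) by apply: val_inj.
by rewrite -[rshift 1 k]/(unsplit (inr k)) unsplitK !mxE.
Qed.

(** As a left factor, the row move also applies to a block of rows inside a
    larger matrix, and to rectangular matrices. *)
Definition move_row_mx p (i : 'I_p.+1) : 'M[R]_(1 + p) :=
  col_mx (row i 1%:M) (row' i 1%:M).

Lemma mul_move_row_mx p n (i : 'I_p.+1) (N : 'M[R]_(p.+1, n)) :
  move_row_mx i *m N = col_mx (row i N) (row' i N).
Proof.
rewrite /move_row_mx mul_col_mx -row_mul mul1mx; congr col_mx.
by rewrite !row'Esub mul_rowsub_mx mul1mx.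
Qed.

Lemma det_move_row_mx p (i : 'I_p.+1) : \det (move_row_mx i) = (-1) ^+ i.
Proof. by rewrite det_move_row det1 mulr1. Qed.

Lemma det_col_mx_mul m p (u : 'M[R]_(m, m + p)) (Q : 'M[R]_p) (N : 'M[R]_(p, m + p)) :
  \det (col_mx u (Q *m N)) = \det Q * \det (col_mx u N).
Proof.
have -> : col_mx u (Q *m N) = block_mx 1%:M 0 0 Q *m col_mx u N.
  by rewrite mul_block_col mul1mx !mul0mx addr0 add0r.
by rewrite det_mulmx det_ublock det1 mul1r.
Qed.

Lemma det_col_mx_eq0 m p (u : 'M[R]_(m, m + p)) (N : 'M[R]_(p, m + p)) i :
  (forall j, N i j = 0) -> \det (col_mx u N) = 0.
Proof.
move=> H; rewrite (expand_det_row _ (rshift m i)) big1 // => j _.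
by rewrite col_mxEd H mul0r.
Qed.

End RowMoves.

(** * Cartan's formula for determinant forms *)

Section DetForms.
Variable R : realType.

Lemma replace_row_col_mxu m1 m2 n (U U' : 'M[R]_(m1, n)) (N N' : 'M[R]_(m2, n)) i :
  replace_row (lshift m2 i) (col_mx U' N') (col_mx U N) =
  col_mx (replace_row i U' U) N.
Proof.
apply/matrixP => k j; rewrite -(splitK k) !mxE.
case: (fintype.split k) => l; rewrite ?unsplitK /= ?mxE ?(inj_eq (@lshift_inj _ _)) //.
by rewrite eq_rlshift.
Qed.

Lemma replace_row_col_mxd m1 m2 n (U U' : 'M[R]_(m1, n)) (N N' : 'M[R]_(m2, n)) i :
  replace_row (rshift m1 i) (col_mx U' N') (col_mx U N) =
  col_mx U (replace_row i N' N).
Proof.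
apply/matrixP => k j; rewrite -(splitK k) !mxE.
case: (fintype.split k) => l; rewrite ?unsplitK /= ?mxE ?(inj_eq (@rshift_inj _ _)) //.
by rewrite eq_lrshift.
Qed.

Lemma replace_row1 n (u v : 'rV[R]_n) i : replace_row i v u = v.
Proof. by apply/matrixP => k j; rewrite mxE !ord1 eqxx. Qed.

Lemma is_derive_col_mx m1 m2 n (U : R -> 'M[R]_(m1, n)) (N : R -> 'M[R]_(m2, n))
    (t : R) U' N' :
  is_derive t 1 U U' -> is_derive t 1 N N' ->
  is_derive t 1 (fun s => col_mx (U s) (N s)) (col_mx U' N').
Proof.
move=> /is_derive_mxP HU /is_derive_mxP HN; apply/is_derive_mxP => i j.
rewrite mxE (_ : (fun _ => _) = fun s => match fintype.split i with inl k => U s k j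
  | inr k => N s k j end); last by apply/funext => s; rewrite mxE.
by case: (fintype.split i).
Qed.

Lemma is_derive_det_col_mx p (u : R -> 'rV[R]_(1 + p)) (N : R -> 'M[R]_(p, 1 + p))
    (t : R) u' N' :
  is_derive t 1 u u' -> is_derive t 1 N N' ->
  is_derive t 1 (fun s => \det (col_mx (u s) (N s)))
   (\det (col_mx u' (N t)) +
    \sum_i \det (col_mx (u t) (replace_row i N' (N t)))).
Proof.
move=> Hu HN; apply: (is_derive_eq (is_derive_det (is_derive_col_mx Hu HN))).
rewrite big_split_ord big_ord1 /= replace_row_col_mxu replace_row1.
by congr (_ + _); apply: eq_bigr => i _; rewrite replace_row_col_mxd.
Qed.

Lemma det_replace_row0 p (u : 'rV[R]_(1 + p)) (N : 'M[R]_(p, 1 + p)) i :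
  \det (col_mx u (replace_row i 0 N)) = 0.
Proof. by apply: (@det_col_mx_eq0 _ _ _ _ _ i) => j; rewrite !mxE eqxx. Qed.

Variable n : nat.
Local Notation V := 'rV[R]_n.

(** With columns (a_i, L_i) read as the affine functions f_i(x) = a_i + x L_i,
    this is the alternating sum of the f_k df_0 /\ .. ^df_k .. /\ df_p: up to
    the factor p!, the Whitney form of the f_i. *)
Definition det_form p (a : 'rV[R]_(1 + p)) (L : 'M[R]_(n, 1 + p)) : Defs.form R n p :=
  fun x M => \det (col_mx (a + x *m L) (M *m L)).

Lemma is_derive_affine_line m (a : 'rV[R]_m) (L : 'M[R]_(n, m)) (x v : V) (t : R) :
  is_derive t 1 (fun h : R => a + (h *: v + x) *m L) (v *m L).
Proof.
apply: is_derive_affine => h; rewrite -addrA; congr (_ + _).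
by rewrite -[h *: 1]/(h * 1) mulr1 scalerDl -addrA mulmxDl -scalemxAl [LHS]addrC.
Qed.

Lemma is_derive_det_form p a L (x v : V) (N : 'M[R]_(p, n)) :
  is_derive x v (fun y => det_form a L y N)
    (\det (col_mx (v *m L) (N *m L))).
Proof.
apply: is_derive_line; rewrite /det_form.
apply: (is_derive_eq (is_derive_det_col_mx (is_derive_affine_line a L x v 0)
   (is_derive_cst (N *m L) (0 : R) 1))).
by rewrite big1 ?addr0 // => i _; rewrite det_replace_row0.
Qed.

(** Differentiating the first row along v_i replaces it by v_i L; moving this
    row back to position i gives p+1 times the same determinant. *)
Lemma ext_d_det_form_sum p (L : 'M[R]_(n, 1 + p)) (M : 'M[R]_(p.+1, n)) :
  \sum_(i < p.+1) (-1) ^+ i * \det (col_mx (row i M *m L) (row' i M *m L)) =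
   p.+1%:R * \det (M *m L : 'M[R]_(1 + p)).
Proof.
rewrite (eq_bigr (fun=> \det (M *m L : 'M[R]_(1 + p)))) => [|i _].
  by rewrite sumr_const card_ord mulr_natl.
by rewrite -mul_col_mx -mul_move_row_mx -mulmxA det_mulmx det_move_row_mx signrMK.
Qed.

Lemma is_derive_scaled (U : normedModType R) (f : U -> R) (x v : U) (k d : R) :
  is_derive x v f d -> is_derive x v (fun y => k * f y) (k * d).
Proof. by move=> H; apply: is_deriveZ. Qed.

Lemma ext_d_det_forms p (S : Type) (r : seq S) (g : S -> R)
    (a : S -> 'rV[R]_(1 + p)) (L : S -> 'M[R]_(n, 1 + p))
    (x : V) (M : 'M[R]_(p.+1, n)) :
  ext_d (fun x M => \sum_(s <- r) g s * det_form (a s) (L s) x M) x M =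
  \sum_(s <- r) g s * (p.+1%:R * \det (M *m L s : 'M[R]_(1 + p))).
Proof.
rewrite /ext_d.
under [RHS]eq_bigr do rewrite -ext_d_det_form_sum mulr_sumr.
rewrite exchange_big; apply: eq_bigr => i _ /=.
under [RHS]eq_bigr do rewrite mulrCA.
rewrite -mulr_sumr; congr (_ * _); apply: derive_val.
apply: is_derive_bigsum => s _; apply: is_derive_scaled.
exact: is_derive_det_form.
Qed.

Section Cartan.
Variables (A : 'M[R]_n) (b : V).
Let X (x : V) := b + x *m A.

(** Only the first two rows depend on y, which gives the two terms. *)
Lemma is_derive_interior_det_form p a L (x v : V) (N : 'M[R]_(p, n)) :
  is_derive x v (fun y => interior_prod X (det_form (p := p.+1) a L) y N)
   (\det (col_mx (v *m L) (col_mx (X x) N *m L)) +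
    \det (col_mx (a + x *m L) (col_mx (v *m A) N *m L))).
Proof.
apply: is_derive_line; rewrite /interior_prod /det_form.
have HN : is_derive (0 : R) 1 (fun h : R => col_mx (X (h *: v + x)) N *m L)
    (col_mx (v *m A) 0 *m L).
  apply: (is_derive_eq (is_derive_mulmx (is_derive_col_mx
    (is_derive_affine_line b A x v 0) (is_derive_cst N (0 : R) 1)) (is_derive_cst L (0 : R) 1))).
  by rewrite mulmx0 addr0.
apply: (is_derive_eq (is_derive_det_col_mx (is_derive_affine_line a L x v 0) HN)).
rewrite scale0r add0r; congr (_ + _).
rewrite (@big_split_ord _ _ _ 1) big_ord1 /= big1 ?addr0.
  by rewrite !mul_col_mx mul0mx (@replace_row_col_mxu 1 p) replace_row1.
move=> i _; rewrite !mul_col_mx mul0mx (@replace_row_col_mxd 1 p).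
apply: (@det_col_mx_eq0 _ _ _ _ _ (rshift 1 i)) => j.
by rewrite (@col_mxEd _ 1 p) !mxE eqxx.
Qed.

(** At time t the form is evaluated at phi_t(x) on the rows of M exp(tA). *)
Lemma is_derive_pullback_det_form p a L (x : V) (M : 'M[R]_(p, n)) :
  is_derive (0 : R) 1 (fun t => pullback (flow X t) (det_form a L) x M)
   (\det (col_mx (X x *m L) (M *m L)) +
    \sum_i \det (col_mx (a + x *m L) (replace_row i (M *m A *m L) (M *m L)))).
Proof.
rewrite /pullback (_ : (fun t => _) = fun t : R =>
   \det (col_mx (a + flow X t x *m L) (M *m mx_exp A t *m L))); last first.
  apply/funext => t; rewrite /det_form; congr (\det (col_mx _ (_ *m L))).
  apply/row_matrixP => j; rewrite row_mul rowK.
  exact: derive_affine_flow.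
have Hu : is_derive (0 : R) 1 (fun t => a + flow X t x *m L) (X x *m L).
  apply: (is_derive_eq (is_deriveD (is_derive_cst a (0 : R) 1)
    (is_derive_mulmx (is_derive_affine_flow A b 0 x) (is_derive_cst L (0 : R) 1)))).
  by rewrite mulmx0 addr0 add0r affine_flow0.
have HN : is_derive (0 : R) 1 (fun t => M *m mx_exp A t *m L) (M *m A *m L).
  apply: (is_derive_eq (is_derive_mulmx (is_derive_mulmx (is_derive_cst M (0 : R) 1)
     (is_derive_mx_exp A 0)) (is_derive_cst L (0 : R) 1))).
  by rewrite mulmx0 addr0 mul0mx add0r mx_exp0 mulmx1.
apply: (is_derive_eq (is_derive_det_col_mx Hu HN)).
by rewrite mx_exp0 mulmx1 affine_flow0.
Qed.

(** The terms that differentiate X inside d (X _| w) are those where the Lie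
    derivative moves the argument vectors.  The terms that differentiate the
    form give -(p+1) times the determinant of which X _| dw is p+2 times, and
    the one left over is the Lie derivative along X of the first row. *)
Lemma det_form_cartan p a (L : 'M[R]_(n, 1 + p.+1)) (x : V) (M : 'M[R]_(p.+1, n)) :
  \det (col_mx (X x *m L) (M *m L)) +
    \sum_i \det (col_mx (a + x *m L) (replace_row i (M *m A *m L) (M *m L))) =
  p.+2%:R * \det (col_mx (X x) M *m L) +
  \sum_(i < p.+1) (-1) ^+ i *
   (\det (col_mx (row i M *m L) (col_mx (X x) (row' i M) *m L)) +
    \det (col_mx (a + x *m L) (col_mx (row i M *m A) (row' i M) *m L))).
Proof.
under [in RHS]eq_bigr do rewrite mulrDr.
rewrite big_split /= addrA; congr (_ + _); last first.
  apply: eq_bigr => i _; pose N := replace_row i (M *m A *m L) (M *m L).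
  have -> : col_mx (row i M *m A) (row' i M) *m L = move_row_mx R i *m N.
    rewrite mul_move_row_mx mul_col_mx; congr col_mx.
      by apply/matrixP => k j; rewrite -!row_mul !mxE eqxx.
    apply/matrixP => k j; rewrite !mxE eq_sym (negbTE (neq_lift _ _)).
    by apply: eq_bigr => l _; rewrite !mxE.
  by rewrite det_col_mx_mul det_move_row_mx signrMK.
rewrite -mul_col_mx.
rewrite (eq_bigr (fun=> - \det (col_mx (X x) M *m L : 'M[R]_(1 + p.+1)))).
  by rewrite sumr_const card_ord mulNrn mulr_natl mulrS addrK.
move=> i _.
have -> : col_mx (row i M *m L) (col_mx (X x) (row' i M) *m L) =
   move_row_mx R (rshift 1 i) *m (col_mx (X x) M *m L).
  rewrite -mul_col_mx mulmxA mul_move_row_mx; congr (_ *m L).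
  congr col_mx; first by apply/rowP => j; rewrite !mxE (@unsplitK 1 p.+1 (inr i)).
  apply/matrixP => k j; rewrite [RHS]mxE.
  rewrite -[k]/(k : 'I_(1 + p)) -(@splitK 1 p k).
  case: (@fintype.split 1 p k) => l.
    have -> : lift (rshift 1 i) (@unsplit 1 p (inl l)) = @lshift 1 p.+1 l.
      by apply: val_inj; rewrite /= /bump ord1.
    by rewrite !(@col_mxEu _ 1).
  have -> : lift (rshift 1 i) (@unsplit 1 p (inr l)) = @rshift 1 p.+1 (lift i l).
    by apply: val_inj; rewrite /= /bump !add1n ltnS addnS.
  by rewrite !(@col_mxEd _ 1) !mxE.
rewrite det_mulmx det_move_row_mx exprD expr1 -mulrA mulN1r mulrN.
by rewrite signrMK.
Qed.

(** Both sides are additive in the form, as all derivatives exist.  For p = 0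
    the contraction term vanishes, and the other two are the derivative of a
    function along X. *)
Lemma cartan_det_forms p (S : Type) (r : seq S) (g : S -> R)
    (a : S -> 'rV[R]_(1 + p)) (L : S -> 'M[R]_(n, 1 + p)) (F : Defs.form R n p)
    (x : V) (M : 'M[R]_(p, n)) :
  (forall x M, F x M = \sum_(s <- r) g s * det_form (a s) (L s) x M) ->
  lie_derivative X F x M =
    interior_prod X (ext_d F) x M + d_interior_prod X F x M.
Proof.
move=> FE.
have {FE} -> : F = fun x M => \sum_(s <- r) g s * det_form (a s) (L s) x M.
  by apply/funext => y; apply/funext => N.
have -> : lie_derivative X
     (fun x M => \sum_(s <- r) g s * det_form (a s) (L s) x M) x M =
   \sum_(s <- r) g s * (\det (col_mx (X x *m L s) (M *m L s)) +
     \sum_i \det (col_mx (a s + x *m L s)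
                (replace_row i (M *m A *m L s) (M *m L s)))).
  rewrite /lie_derivative derive1E; apply: derive_val.
  apply: is_derive_bigsum => s _; apply: is_derive_scaled.
  exact: is_derive_pullback_det_form.
rewrite {1}/interior_prod ext_d_det_forms.
case: p {F} a L M => [|q] a L M.
  rewrite addr0; apply: eq_bigr => s _; rewrite big_ord0 addr0 mul1r.
  by rewrite (@mul_col_mx _ 1 0).
rewrite (_ : d_interior_prod _ _ _ _ = \sum_(s <- r) g s *
   \sum_(i < q.+1) (-1) ^+ i *
   (\det (col_mx (row i M *m L s) (col_mx (X x) (row' i M) *m L s)) +
    \det (col_mx (a s + x *m L s) (col_mx (row i M *m A) (row' i M) *m L s)))).
  rewrite -big_split; apply: eq_bigr => s _ /=.
  by rewrite -mulrDr det_form_cartan.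
rewrite /= /ext_d.
under [RHS]eq_bigr do rewrite mulr_sumr.
rewrite exchange_big; apply: eq_bigr => i _ /=.
under [RHS]eq_bigr do rewrite mulrCA.
rewrite -mulr_sumr; congr (_ * _); apply: derive_val.
apply: is_derive_bigsum => s _; apply: is_derive_scaled.
exact: is_derive_interior_det_form.
Qed.

End Cartan.
End DetForms.

(** * Barycentric coordinates *)

Section Barycentric.
Variables (R : realType) (n : nat).
Local Notation V := 'rV[R]_n.
Implicit Types (s T : {fset V}) (v : seq V).

Lemma bary_notin s i x : i \notin s -> bary s i x = 0.
Proof.
by rewrite /bary; case: xgetP => [w _ [H _ _] /H|//].
Qed.

Lemma bary_unique s (w : V -> R) x :
  affinely_independent s -> (forall u, u \notin s -> w u = 0) ->
  \sum_(u <- s) w u = 1 -> \sum_(u <- s) w u *: u = x -> forall u, bary s u x = w u.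
Proof.
move=> aff w0 w1 wx.
move=> i; rewrite /bary; congr (_ i).
apply: xget_unique => [|w' [w'0 w'1 w'x]]; first by split.
apply/funext => u; have [us|us] := boolP (u \in s); last by rewrite w0 ?w'0.
apply/eqP; rewrite -subr_eq0; apply/eqP; apply: (aff (fun u => w' u - w u)) => //.
  by rewrite sumrB w1 w'1 subrr.
under eq_bigr do rewrite scalerBl.
by rewrite sumrB wx w'x subrr.
Qed.

Definition vertex_mx m v : 'M[R]_(m, n) := \matrix_(k < m) nth 0 v k.

(** Serves both for the points of a lower-dimensional simplex, where integrals
    are taken, and for all points of the space when the simplex is
    full-dimensional. *)
Lemma bary_combination s v m (beta : 'rV[R]_m) (k : 'I_m) :
  affinely_independent s -> perm_eq v (enum_fset s) -> size v = m ->
  \sum_j beta 0 j = 1 -> bary s (nth 0 v k) (beta *m vertex_mx m v) = beta 0 k.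
Proof.
move=> aff pv sv b1.
have uv : uniq v by rewrite (perm_uniq pv) fset_uniq.
pose w u := \sum_(j < m) (nth 0 v j == u)%:R * beta 0 j.
have sum_w (W : lmodType R) (F : V -> W) :
    \sum_(u <- s) w u *: F u = \sum_(j < m) beta 0 j *: F (nth 0 v j).
  rewrite -(perm_big _ pv) /=.
  under eq_bigr do rewrite scaler_suml.
  rewrite exchange_big /=; apply: eq_bigr => j _.
  have jv : nth 0 v j \in v by rewrite mem_nth // sv.
  rewrite (bigD1_seq _ jv uv) /= eqxx mul1r big1 ?addr0 // => u.
  by rewrite eq_sym => /negbTE ->; rewrite mul0r scale0r.
rewrite (@bary_unique s w _ aff).
- rewrite /w (bigD1 k) //= eqxx mul1r big1 ?addr0 // => j jk.
  by rewrite nth_uniq ?sv // (inj_eq val_inj) (negbTE jk) mul0r.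
- move=> u us; rewrite /w big1 // => j _.
  case: eqP => [ju|_]; last by rewrite mul0r.
  by move: us; rewrite -ju -(perm_mem pv) mem_nth // sv.
- have := sum_w R^o (fun=> 1); under eq_bigr do rewrite /GRing.scale /= mulr1.
  by move=> ->; under eq_bigr do rewrite /GRing.scale /= mulr1.
- rewrite sum_w mulmx_sum_row; apply: eq_bigr => j _.
  by rewrite rowK.
Qed.

(** The tangent vectors of the affine hull are the combinations e of the
    vertices with total weight 0; the coordinates are affine along them even
    when they are not differentiable in the ambient space. *)
Lemma is_derive_bary s v m (beta : 'rV[R]_m) (e : 'rV[R]_m) (k : 'I_m) :
  affinely_independent s -> perm_eq v (enum_fset s) -> size v = m ->
  \sum_j beta 0 j = 1 -> \sum_j e 0 j = 0 ->
  is_derive (beta *m vertex_mx m v) (e *m vertex_mx m v)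
    (bary s (nth 0 v k)) (e 0 k).
Proof.
move=> aff pv sv b1 e0; apply: is_derive_affine => h.
rewrite scalemxAl -mulmxDl !bary_combination //.
  by rewrite !mxE addrC.
under eq_bigr do rewrite !mxE.
by rewrite big_split /= -mulr_sumr e0 mulr0 add0r.
Qed.

(** The offsets al and gradients l of the coordinates on a full-dimensional
    simplex; the last two fields split sum mu_i = 1 into its constant and linear
    parts. *)
Record bary_affine_spec T (al : V -> R) (l : V -> 'cV[R]_n) : Prop := {
  bary_affineE : forall i x, bary T i x = al i + (x *m l i) 0 0;
  bary_affine_sum1 : \sum_(i <- T) al i = 1;
  bary_affine_sum0 : \sum_(i <- T) l i = 0 }.

(** The n+1 rows (1, v_j) form an invertible matrix by affine independence, and
    the coordinates of x are the entries of (1, x) times its inverse. *)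
Lemma bary_affine T : affinely_independent T -> #|` T| = n.+1 ->
  exists al l, bary_affine_spec T al l.
Proof.
move=> aff cT; pose v : seq V := enum_fset T.
have sv : size v = n.+1 by rewrite -cT.
have pv : perm_eq v (enum_fset T) by [].
have uv : uniq v by exact: fset_uniq.
pose B : 'M[R]_(n.+1, 1 + n) := row_mx (const_mx 1) (vertex_mx n.+1 v).
have Bu : B \in unitmx.
  rewrite -row_free_unit -kermx_eq0; apply/rowV0P => c /sub_kermxP cB.
  have {cB} : c *m B = 0 :> 'M[R]_(1, 1 + n) by exact: cB.
  rewrite /B mul_mx_row => /eqP; rewrite row_mx_eq0 => /andP[/eqP c1 /eqP cV].
  pose w u := c 0 (inord (index u v)).
  have sum_w (W : lmodType R) (F : V -> W) :
    \sum_(u <- T) w u *: F u = \sum_(j < n.+1) c 0 j *: F (nth 0 v j).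
    rewrite (big_nth 0) big_mkord sv; apply: eq_bigr => j _.
    by rewrite /w index_uniq ?sv // inord_val.
  apply/rowP => j; rewrite mxE.
  have -> : c 0 j = w (nth 0 v j) by rewrite /w index_uniq ?sv // inord_val.
  apply: aff; last by rewrite mem_nth // sv.
    have := sum_w R^o (fun=> 1); under eq_bigr do rewrite /GRing.scale /= mulr1.
    move=> ->; under eq_bigr do rewrite /GRing.scale /= mulr1.
    have := congr1 (fun M : 'M[R]_1 => M 0 0) c1; rewrite !mxE => c10.
    apply: etrans c10; by apply: eq_bigr => i _; rewrite mxE mulr1.
  rewrite sum_w -[RHS]cV mulmx_sum_row; apply: eq_bigr => i _.
  by rewrite rowK.
pose C : 'M[R]_(1 + n, n.+1) := invmx B.
have BC (y : 'rV[R]_(1 + n)) : y *m C *m B = y by rewrite -mulmxA mulVmx // mulmx1.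
pose ind i : 'I_n.+1 := inord (index i v).
pose beta x := row_mx 1%:M x *m C.
have betaP x : beta x *m vertex_mx n.+1 v = x /\ \sum_j beta x 0 j = 1.
  have := BC (row_mx 1%:M x); rewrite /B mul_mx_row => /eq_row_mx[b1 bx].
  split=> //; have := congr1 (fun M : 'M[R]_1 => M 0 0) b1.
  rewrite !mxE eqxx => b11; apply: etrans b11.
  by apply: eq_bigr => j _; rewrite [const_mx _ _ _]mxE mulr1.
have baryE x (j : 'I_n.+1) : bary T (nth 0 v j) x = beta x 0 j.
  have [bx sb] := betaP x.
  by rewrite -(bary_combination j aff pv sv sb) bx.
pose al i := if i \in T then usubmx C 0 (ind i) else 0.
pose l i := if i \in T then col (ind i) (dsubmx C) else 0.
have alE i x : bary T i x = al i + (x *m l i) 0 0.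
  rewrite /al /l; case: ifPn => [iT|iT]; last first.
    by rewrite bary_notin // mulmx0 mxE addr0.
  have iE : nth 0 v (ind i) = i.
    by rewrite /ind inordK ?nth_index // -sv index_mem.
  rewrite -[i in LHS]iE baryE /beta -(vsubmxK C) mul_row_col mul1mx mxE.
  congr (_ + _); first by rewrite col_mxKu.
  by rewrite col_mxKd colE mulmxA -colE [RHS]mxE.
exists al, l.
have sum1 (x : V) : \sum_(i <- T) al i + (x *m \sum_(i <- T) l i) 0 0 = 1.
  rewrite mulmx_sumr summxE -big_split.
  rewrite (eq_bigr (fun i => bary T i x)) => [|i _]; last by rewrite alE.
  rewrite (big_nth 0) big_mkord sv -(betaP x).2.
  by apply: eq_bigr => j _; rewrite baryE.
have a1 : \sum_(i <- T) al i = 1 by rewrite -(sum1 0) mul0mx mxE addr0.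
split=> //; apply/colP => k; rewrite [RHS]mxE.
have := sum1 (delta_mx 0 k); rewrite a1 -rowE !mxE => /eqP.
by rewrite -subr_eq0 addrAC subrr add0r => /eqP.
Qed.

Lemma derive_bary_affine T al l i x u : bary_affine_spec T al l ->
  'D_u (bary T i) x = (u *m l i) 0 0.
Proof.
move=> [E _ _]; apply: derive_val; apply: is_derive_affine => h.
by rewrite !E mulmxDl -scalemxAl !mxE addrCA [RHS]addrC.
Qed.

End Barycentric.

(** * Determinants indexed by ordered simplices *)

Section VertexRows.
Variables (R : realType) (n : nat).
Local Notation V := 'rV[R]_n.
Implicit Types (s t : seq V).

Definition family_mx m k (rho : V -> 'rV[R]_k) s : 'M[R]_(m, k) :=
  \matrix_(i < m) rho (nth 0 s i).

Lemma family_mx_cons m k (rho : V -> 'rV[R]_k) v s :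
  family_mx (1 + m) rho (v :: s) = col_mx (rho v) (family_mx m rho s).
Proof.
apply/row_matrixP => i; rewrite rowK -(@splitK 1 m i).
case: (@fintype.split 1 m i) => j /=; first by rewrite ord1 rowKu row_id.
by rewrite rowKd rowK.
Qed.

Lemma ord_signE m s t : size s = m ->
  ord_sign s t = \det (\matrix_(i < m, j < m) (nth 0 s i == nth 0 t j)%:R).
Proof. by move=> <-. Qed.

(** The permutation matrix of the inverse permutation is the transpose. *)
Lemma ord_signC s t : size s = size t -> ord_sign s t = ord_sign t s.
Proof.
move=> st; rewrite (ord_signE t st) /ord_sign -det_tr; congr (\det _).
by apply/matrixP => i j; rewrite !mxE eq_sym.
Qed.

(** The rows of s are those of t permuted by the matrix that defines the sign. *)
Lemma det_family_mx_perm m (rho : V -> 'rV[R]_(1 + m)) v s t :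
  size s = m -> uniq t -> perm_eq s t ->
  \det (family_mx (1 + m) rho (v :: s)) =
  ord_sign s t * \det (family_mx (1 + m) rho (v :: t)).
Proof.
move=> sm ut pst; have tm : size t = m by rewrite -(perm_size pst).
rewrite (ord_signE t sm) !family_mx_cons -det_col_mx_mul; congr (\det (col_mx _ _)).
apply/row_matrixP => i; rewrite rowK row_mul mulmx_sum_row.
set w := nth 0 s i; have it : w \in t by rewrite -(perm_mem pst) mem_nth // sm.
have kt : (index w t < m)%N by rewrite -tm index_mem.
rewrite (bigD1 (Ordinal kt)) //= rowK !mxE -/w. rewrite nth_index // eqxx scale1r.
rewrite big1 ?addr0 // => j jk; rewrite !mxE -/w.
case: eqP => [ij|_]; last by rewrite scale0r.
by case/eqP: jk; apply: val_inj; rewrite /= ij index_uniq ?tm.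
Qed.

Lemma det_family_mx_rem m (rho : V -> 'rV[R]_m.+1) v s : size s = m.+1 -> v \in s ->
  \det (family_mx (1 + m) rho (v :: rem v s)) =
  (-1) ^+ index v s * \det (family_mx m.+1 rho s).
Proof.
move=> sm vs; have km : (index v s < m.+1)%N by rewrite -sm index_mem.
rewrite -(det_move_row _ (Ordinal km)) family_mx_cons; congr (\det (col_mx _ _)).
  by rewrite rowK /= nth_index.
apply/row_matrixP => i; rewrite rowK; apply/rowP => j; rewrite !mxE /=.
congr (rho _ _ _); rewrite remE nth_cat size_takel; last by rewrite sm ltnW.
rewrite /bump; case: ltnP => ik.
  by rewrite nth_take // leqNgt ik.
by rewrite nth_drop add1n addSn subnKC.
Qed.

Lemma det_family_mx_eq0 m (rho : V -> 'rV[R]_(1 + m)) v s : size s = m -> v \in s ->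
  \det (family_mx (1 + m) rho (v :: s)) = 0.
Proof.
move=> sm vs; have km : (index v s < m)%N by rewrite -sm index_mem.
apply: (@determinant_alternate _ _ _ (lshift m ord0) (rshift 1 (Ordinal km))).
  by rewrite eq_lrshift.
by move=> j; rewrite !mxE /=; congr (rho _ 0 j); exact/esym/(nth_index 0 vs).
Qed.

Lemma sum_det_col_mx m (I : Type) (r : seq I) (u : I -> 'rV[R]_(1 + m)) N :
  \sum_(i <- r) \det (col_mx (u i) N) = \det (col_mx (\sum_(i <- r) u i) N).
Proof.
rewrite (expand_det_row _ (lshift m ord0)).
under [RHS]eq_bigr do rewrite col_mxEu summxE mulr_suml.
rewrite [RHS]exchange_big; apply: eq_bigr => i _ /=.
rewrite (expand_det_row _ (lshift m ord0)); apply: eq_bigr => j _.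
rewrite col_mxEu /cofactor; congr (_ * (_ * \det _)).
apply/matrixP => k l; rewrite !mxE.
have -> : lift (lshift m ord0) k = rshift 1 k :> 'I_(1 + m) by apply: val_inj.
by rewrite (@unsplitK 1 m (inr k)).
Qed.

End VertexRows.

(** * Whitney forms as determinants *)

Section WhitneySimplex.
Variables (R : realType) (n : nat).
Local Notation V := 'rV[R]_n.
Implicit Types (s t : seq V) (T : {fset V}).

Definition whitney_row p T (x : V) (M : 'M[R]_(p, n)) (u : V) : 'rV[R]_(1 + p) :=
  row_mx (bary T u x)%:M (\row_j 'D_(row j M) (bary T u) x).

(** The defining alternating sum is the Laplace expansion along the column of
    the values mu_(s_k)(x). *)
Lemma whitney_simplexE p s T (x : V) (M : 'M[R]_(p, n)) :
  whitney_simplex s T x M =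
  p`!%:R * \det (family_mx (1 + p) (whitney_row T x M) s).
Proof.
rewrite /whitney_simplex; congr (_ * _).
rewrite (expand_det_col _ (lshift p ord0)); apply: eq_bigr => k _.
rewrite /cofactor /= addn0 mulrCA mulrA.
have -> : family_mx (1 + p) (whitney_row T x M) s k (lshift p ord0) =
    bary T (nth 0 s k) x.
  by rewrite mxE row_mxEl mxE eqxx mulr1n.
congr (_ * _); apply: (congr1 (fun A : 'M[R]_p => \det A)).
apply/matrixP => i j; rewrite mxE [RHS]mxE [RHS]mxE mxE.
have -> : lift (lshift p ord0) (j : 'I_(1 + p).-1) = rshift 1 j.
  exact: val_inj.
by rewrite row_mxEr mxE.
Qed.

Lemma whitney_row_affine T al l p x (M : 'M[R]_(p, n)) u :
  bary_affine_spec T al l ->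
  whitney_row T x M u = row_mx (al u + (x *m l u) 0 0)%:M (M *m l u)^T.
Proof.
move=> H; rewrite /whitney_row (bary_affineE H); congr row_mx.
apply/rowP => j; rewrite mxE (derive_bary_affine _ _ _ H) -row_mul !mxE.
by apply: eq_bigr.
Qed.

(** The coordinate of a vertex outside T is identically 0, hence so is the
    corresponding row. *)
Lemma whitney_simplex_notface p s T (x : V) (M : 'M[R]_(p, n)) u :
  size s = p.+1 -> u \in s -> u \notin T -> whitney_simplex s T x M = 0.
Proof.
move=> sp us uT; rewrite whitney_simplexE.
have ks : (index u s < 1 + p)%N by rewrite add1n -sp index_mem.
rewrite (expand_det_row _ (Ordinal ks)) big1 ?mulr0 // => j _.
rewrite [family_mx _ _ _ _ _]mxE /= nth_index //.
suff -> : whitney_row T x M u = 0 by rewrite mxE mul0r.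
have b0 : bary T u = cst 0 by apply/funext => y; exact: bary_notin.
rewrite /whitney_row b0 /= raddf0.
rewrite (_ : (\row_j _) = 0); first by rewrite row_mx0.
by apply/rowP => k; rewrite !mxE; apply: derive_cst.
Qed.

End WhitneySimplex.

(** * The Whitney map commutes with the coboundary *)

Section Coboundary.
Variables (R : realType) (n : nat) (K : oriented_complex R n).
Hypothesis HK : is_oriented_complex K.
Local Notation V := 'rV[R]_n.
Implicit Types (s t u T : {fset V}).

Lemma size_vord s : faces K s -> size (vord K s) = #|` s|.
Proof. by move=> /(vord_perm HK) /perm_size ->. Qed.

Lemma mem_vord s v : faces K s -> (v \in vord K s) = (v \in s).
Proof. by move=> /(vord_perm HK) /perm_mem ->. Qed.

Lemma uniq_vord s : faces K s -> uniq (vord K s).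
Proof. by move=> /(vord_perm HK) /perm_uniq ->; exact: fset_uniq. Qed.

Lemma sub_face s T m : faces K T -> (s `<=` T)%fset -> #|` s| = m.+1 -> faces K s.
Proof.
move=> fT sT sm; apply: (face_closed HK fT sT).
by rewrite -cardfs_eq0 sm.
Qed.

Lemma fsum_simplices p (r : seq {fset V}) (f : {fset V} -> R) : uniq r ->
  (forall t, t \in r -> simplices K p t) ->
  (forall t, simplices K p t -> t \notin r -> f t = 0) ->
  \sum_(t \in simplices K p) f t = \sum_(t <- r) f t.
Proof.
move=> ur rs f0; rewrite (fsbigE r) //.
rewrite big_seq_cond [RHS]big_seq; apply: eq_bigl => t.
by rewrite andb_idr // => /rs ?; exact/mem_set.
Qed.

(** Turns the sum over all simplices of a possibly infinite complex into a
    finite one. *)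
Lemma whitney_faces p (c : cochain R n) T (x : V) (M : 'M[R]_(p, n)) :
  faces K T -> whitney K p c T x M =
  \sum_(s <- fpowerset T | #|` s| == p.+1) c s * whitney_simplex (vord K s) T x M.
Proof.
move=> fT; rewrite /whitney.
pose r := [seq s <- fpowerset T | #|` s| == p.+1].
rewrite (@fsum_simplices p r) ?big_filter // => [|s|s [fs cs] sr].
- by rewrite filter_uniq // fset_uniq.
- rewrite mem_filter fpowersetE => /andP[/eqP cs sT]; split=> //.
  exact: sub_face fT sT cs.
have /fsubsetPn[u us uT] : ~~ (s `<=` T)%fset.
  by apply: contra sr => sT; rewrite mem_filter fpowersetE cs eqxx.
rewrite (@whitney_simplex_notface _ _ _ _ _ _ _ u) ?mulr0 //.
  by rewrite size_vord.
by rewrite mem_vord.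
Qed.

Lemma boundary_face s v m : faces K s -> #|` s| = m.+2 -> v \in s ->
  faces K (s `\ v)%fset /\ #|` (s `\ v)%fset| = m.+1.
Proof.
move=> fs cs vs; have c : #|` (s `\ v)%fset| = m.+1.
  by move: (cardfsD1 v s); rewrite vs cs add1n => -[].
by split=> //; apply: (sub_face fs _ c); exact: fsubD1set.
Qed.

Lemma coboundaryE p (c : cochain R n) u : faces K u -> #|` u| = p.+2 ->
  coboundary K p c u = \sum_(v <- vord K u)
    (-1) ^+ index v (vord K u) * ord_sign (rem v (vord K u)) (vord K (u `\ v)%fset)
     * c (u `\ v)%fset.
Proof.
move=> fu cu; rewrite /coboundary.
pose r := undup [seq (u `\ v)%fset | v <- vord K u].
have ru v : v \in vord K u -> (u `\ v)%fset \in r.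
  by move=> vu; rewrite mem_undup; apply: map_f.
rewrite (@fsum_simplices p r) => [||t|t _ tr]; last 3 first.
- exact: undup_uniq.
- rewrite mem_undup => /mapP[v]; rewrite mem_vord // => vu ->.
  exact: boundary_face.
- rewrite /boundary_coef big_seq_cond big1 ?mul0r // => v /andP[/ru + /eqP tE].
  by rewrite -tE (negbTE tr).
rewrite /boundary_coef; under eq_bigr do rewrite mulr_suml.
rewrite (exchange_big_dep xpredT) //= big_seq [RHS]big_seq.
apply: eq_bigr => v vu.
by rewrite -big_filter (filter_pred1_uniq (undup_uniq _) (ru v vu)) big_seq1.
Qed.

(** The incidence number of u and its face opposite to v is the sign that
    relates the chosen order of u to the order (v, u \ v). *)
Lemma boundary_whitney p u v T (x : V) (M : 'M[R]_(p.+1, n)) :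
  faces K u -> #|` u| = p.+2 -> v \in u ->
  (-1) ^+ index v (vord K u) * ord_sign (rem v (vord K u)) (vord K (u `\ v)%fset)
     * whitney_simplex (vord K u) T x M =
  whitney_simplex (v :: vord K (u `\ v)%fset) T x M.
Proof.
move=> fu cu vu; have [fuv cuv] := boundary_face fu cu vu.
have su : size (vord K u) = p.+2 by rewrite size_vord.
have suv : size (vord K (u `\ v)%fset) = p.+1 by rewrite size_vord.
have vv : v \in vord K u by rewrite mem_vord.
have uu : uniq (vord K u) by exact: uniq_vord.
have pr : perm_eq (vord K (u `\ v)%fset) (rem v (vord K u)).
  apply: uniq_perm => [||y]; [exact: uniq_vord|exact: rem_uniq|].
  by rewrite mem_rem_uniq // inE mem_vord // mem_vord // !inE.
rewrite !whitney_simplexE (det_family_mx_perm _ _ suv (rem_uniq _ uu) pr).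
rewrite (det_family_mx_rem _ su vv) ord_signC ?(perm_size pr) //.
by rewrite mulrCA; congr (_ * _); rewrite mulrA [X in X * _]mulrC.
Qed.

(** For fixed v, removing v is a bijection from the faces with v to those
    without. *)
Lemma sum_faces_remove (T : {fset V}) m v (G : {fset V} -> R) : v \in T ->
  \sum_(u <- fpowerset T | (#|` u| == m.+1) && (v \in u)) G (u `\ v)%fset =
  \sum_(t <- fpowerset T | (#|` t| == m) && (v \notin t)) G t.
Proof.
move=> vT; rewrite -big_filter -[RHS]big_filter.
rewrite -(big_map (fun u => (u `\ v)%fset) xpredT G); apply: perm_big.
apply: uniq_perm => [||t].
- rewrite map_inj_in_uniq ?filter_uniq ?fset_uniq // => u u'.
  rewrite !mem_filter => /andP[/andP[_ vu] _] /andP[/andP[_ vu'] _] uu'.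
  by rewrite -(fsetD1K vu) uu' fsetD1K.
- by rewrite filter_uniq // fset_uniq.
rewrite mem_filter fpowersetE; apply/mapP/idP => [[u]|/andP[/andP[/eqP ct vt] tT]].
  rewrite mem_filter fpowersetE => /andP[/andP[cu vu] uT] ->.
  rewrite !inE eqxx /= andbT (fsubset_trans (fsubD1set _ _) uT) andbT.
  by move: cu; rewrite (cardfsD1 v) vu add1n eqSS.
exists (v |` t)%fset; last by rewrite fsetU1K.
rewrite mem_filter fpowersetE cardfsU1 vt ct add1n eqxx fset1U1 /=.
by rewrite fsubUset fsub1set vT.
Qed.

(** The double sum over cofaces u and vertices v of u is a double sum over
    t = u \ v and v outside t; the vertices v of t may be added at no cost, as
    the form of (v, t) then has a repeated vertex. *)
Lemma whitney_coboundary p (c : cochain R n) T (x : V) (M : 'M[R]_(p.+1, n)) :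
  faces K T -> whitney K p.+1 (coboundary K p c) T x M =
  \sum_(t <- fpowerset T | #|` t| == p.+1)
    c t * \sum_(v <- T) whitney_simplex (v :: vord K t) T x M.
Proof.
move=> fT; rewrite whitney_faces //.
pose G v t := c t * whitney_simplex (v :: vord K t) T x M.
transitivity (\sum_(u <- fpowerset T | #|` u| == p.+2)
   \sum_(v <- T | v \in u) G v (u `\ v)%fset).
  rewrite big_seq_cond [RHS]big_seq_cond; apply: eq_bigr => u.
  rewrite fpowersetE => /andP[uT /eqP cu]; have fu := sub_face fT uT cu.
  rewrite coboundaryE // mulr_suml -[RHS]big_filter.
  rewrite [RHS](@perm_big _ _ _ _ _ (vord K u)) /=; last first.
    apply: uniq_perm => [||y]; [by rewrite filter_uniq // fset_uniq|exact: uniq_vord|].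
    rewrite mem_vord // mem_filter; apply/andP/idP => [[]//|yu].
    by split=> //; exact: (fsubsetP uT).
  apply: eq_big_seq => v; rewrite (mem_vord _ fu) => vu.
  by rewrite /G -boundary_whitney // mulrAC mulrC.
transitivity (\sum_(t <- fpowerset T | #|` t| == p.+1)
   \sum_(v <- T | v \notin t) G v t).
  rewrite [LHS](exchange_big_dep xpredT) => [|//].
  rewrite [RHS](exchange_big_dep xpredT) => [|//].
  apply: eq_big_seq => v vT.
  exact: (sum_faces_remove _ (G v)).
rewrite big_seq_cond [RHS]big_seq_cond; apply: eq_bigr => t.
rewrite fpowersetE => /andP[tT /eqP ct]; have ft := sub_face fT tT ct.
rewrite mulr_sumr [RHS](bigID (fun v => v \notin t)) /= [X in _ + X]big1 ?addr0 //.
move=> v; rewrite negbK => vt; rewrite whitney_simplexE.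
by rewrite det_family_mx_eq0 ?mulr0 ?mem_vord ?size_vord.
Qed.

(** By linearity in the first row, which sums to (sum mu_v, sum d mu_v) =
    (1, 0). *)
Lemma sum_whitney_cons p (s : seq V) T (x : V) (M : 'M[R]_(p.+1, n)) al l :
  bary_affine_spec T al l ->
  \sum_(v <- T) whitney_simplex (v :: s) T x M =
  p.+1`!%:R * \det (M *m \matrix_(k < n, i < p.+1) l (nth 0 s i) k 0).
Proof.
move=> H; under eq_bigr do rewrite whitney_simplexE family_mx_cons.
rewrite -mulr_sumr sum_det_col_mx; congr (_ * _).
have -> : \sum_(v <- T) whitney_row T x M v = row_mx 1%:M 0.
  under eq_bigr do rewrite (whitney_row_affine _ _ _ H).
  rewrite -[LHS]hsubmxK !linear_sum /=; congr row_mx.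
    under eq_bigr do rewrite row_mxKl.
    rewrite -raddf_sum big_split /= (bary_affine_sum1 H) -summxE -mulmx_sumr.
    by rewrite (bary_affine_sum0 H) mulmx0 mxE addr0.
  under eq_bigr do rewrite row_mxKr.
  by rewrite -linear_sum -mulmx_sumr (bary_affine_sum0 H) mulmx0 linear0.
rewrite -[family_mx _ _ _]hsubmxK -/(block_mx _ _ _ _) det_lblock det1 mul1r -[RHS]det_tr.
congr (\det _); apply/matrixP => i j.
rewrite [LHS]mxE [LHS]mxE (whitney_row_affine _ _ _ H) row_mxEr.
rewrite !mxE; apply: eq_bigr => k _.
by rewrite !mxE.
Qed.

End Coboundary.

(** * The de Rham map is a left inverse of the Whitney map *)

Section DeRham.
Variables (R : realType) (n : nat).
Local Notation V := 'rV[R]_n.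

(** One step of the iterated integral giving the volume a^p / p! of the
    simplex of size a. *)
Lemma integral_exprB (a c : R) q : 0 <= a ->
  \int[lebesgue_measure]_(t in `[0, a]) (c * (a - t) ^+ q / q`!%:R) =
  c * a ^+ q.+1 / q.+1`!%:R.
Proof.
rewrite le_eqVlt => /predU1P[<-|a0].
  by rewrite set_itv1 Rintegral_set1 expr0n /= mulr0 mul0r.
pose P : {poly R} := - (c / q.+1`!%:R) *: (a%:P - 'X) ^+ q.+1.
have PE t : P.[t] = - (c / q.+1`!%:R) * (a - t) ^+ q.+1.
  by rewrite /P hornerZ horner_exp !hornerE.
have P'E t : (P^`()).[t] = c * (a - t) ^+ q / q`!%:R.
  rewrite /P derivZ deriv_exp derivB derivC derivX sub0r /= !hornerE.
  rewrite !(hornerE, hornerMn) factS natrM.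
  have q1 : q.+1%:R != 0 :> R by rewrite pnatr_eq0.
  have q2 : q`!%:R != 0 :> R by rewrite pnatr_eq0 -lt0n fact_gt0.
  rewrite -mulr_natl; field.
  by rewrite q2 addrC natr1 q1.
rewrite /Rintegral.
under eq_integral do rewrite -P'E.
rewrite (@continuous_FTC2 _ _ (horner P)) //=.
- rewrite !PE subrr subr0 expr0n /= mulr0 sub0r mulNr opprK.
  by rewrite mulrAC.
- exact/continuous_subspaceT/continuous_horner.
- split=> [x _||].
  + exact: derivable_horner.
  + exact/cvg_at_right_filter/continuous_horner.
  + exact/cvg_at_left_filter/continuous_horner.
- by move=> x _; rewrite -derivE.
Qed.

Lemma int_simplex_cst p (a c : R) : 0 <= a ->
  @int_simplex R p a (fun=> c) = c * a ^+ p / p`!%:R.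
Proof.
elim: p a => [|q IH] a a0 /=; first by rewrite fact0 divr1 expr0 mulr1.
rewrite -integral_exprB //; apply: eq_Rintegral => t.
by rewrite inE /= in_itv /= => /andP[_ ta]; rewrite IH // subr_ge0.
Qed.

Variable K : oriented_complex R n.
Hypothesis HK : is_oriented_complex K.

Let ones p : 'cV[R]_p := const_mx 1.

Let sum_ones p m (b : 'M[R]_(m, p)) i : \sum_j b i j = (b *m ones p) i 0.
Proof. by rewrite mxE; apply: eq_bigr => j _; rewrite mxE mulr1. Qed.

(** The point and the edge vectors are the combinations beta and N of the
    vertices, so the determinant is that of the coefficients; adding all columns
    to the first one makes it block triangular with unit diagonal. *)
Lemma whitney_simplex_self p (s : {fset V}) v (t : 'rV[R]_p) :
  affinely_independent s -> perm_eq v (enum_fset s) -> size v = p.+1 ->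
  let E : 'M[R]_(p, n) := \matrix_(j < p) (nth 0 v j.+1 - nth 0 v 0) in
  whitney_simplex v s (nth 0 v 0 + t *m E) E = p`!%:R.
Proof.
move=> aff pv sv E.
pose beta : 'rV[R]_(1 + p) := row_mx (1%:M - t *m ones p) t.
pose N : 'M[R]_(p, 1 + p) := row_mx (- ones p) 1%:M.
have vE : vertex_mx (1 + p) v = col_mx (nth 0 v 0) (\matrix_(j < p) nth 0 v j.+1).
  apply/row_matrixP => i; rewrite rowK -(@splitK 1 p i).
  case: (@fintype.split 1 p i) => j /=; first by rewrite ord1 rowKu row_id.
  by rewrite rowKd rowK.
have EE : E = N *m vertex_mx (1 + p) v.
  rewrite vE mul_row_col mul1mx addrC; apply/matrixP => i j.
  by rewrite !mxE big_ord1 !mxE mulN1r.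
have xE : nth 0 v 0 + t *m E = beta *m vertex_mx (1 + p) v.
  rewrite EE mulmxA mul_mx_row mulmxN mulmx1 vE !mul_row_col mulmxBl mul1mx.
  by rewrite addrA mulNmx.
have onesE : ones (1 + p) = col_mx 1%:M (ones p).
  rewrite /ones -col_mx_const; congr col_mx.
  by apply/matrixP => i j; rewrite !mxE !ord1.
have bo : beta *m ones (1 + p) = 1%:M.
  by rewrite onesE mul_row_col mulmx1 subrK.
have No : N *m ones (1 + p) = 0.
  by rewrite onesE mul_row_col mulmx1 mul1mx addNr.
have b1 : \sum_j beta 0 j = 1 by rewrite sum_ones bo mxE.
have N0 j : \sum_i row j N 0 i = 0 by rewrite sum_ones -row_mul No !mxE.
rewrite whitney_simplexE xE.
have -> : family_mx (1 + p) (whitney_row s (beta *m vertex_mx (1 + p) v) E) v =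
   (col_mx beta N)^T.
  apply/row_matrixP => i; rewrite rowK tr_col_mx row_row_mx /whitney_row.
  congr row_mx.
    rewrite (bary_combination i aff pv sv b1).
    by apply/matrixP => k l; rewrite !ord1 !mxE eqxx.
  apply/rowP => j; rewrite !mxE EE row_mul.
  rewrite (@derive_val _ _ _ _ _ _ _ (is_derive_bary i aff pv sv b1 (N0 j))).
  by rewrite !mxE.
rewrite det_tr.
have : \det (col_mx beta N *m block_mx 1%:M 0 (ones p) 1%:M) = 1.
  rewrite -[col_mx beta N]/(block_mx _ _ _ _) mulmx_block !mulmx1 !mulmx0 !add0r !mul1mx.
  by rewrite subrK addNr det_ublock !det1 mulr1.
by rewrite det_mulmx det_lblock !det1 !mulr1 => ->; rewrite mulr1.
Qed.

(** A p-simplex has no other p-dimensional face, so the integrand is the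
    constant p! c(s). *)
Lemma de_rham_whitney p (c : cochain R n) s : simplices K p s ->
  de_rham K (whitney K p c) s = c s.
Proof.
move=> [fs cs]; rewrite /de_rham /int_form.
rewrite (_ : (fun t => _) = fun=> c s * p`!%:R).
  by rewrite int_simplex_cst // expr1n mulr1 mulfK // pnatr_eq0 -lt0n fact_gt0.
apply/funext => t; rewrite (whitney_faces HK) //.
rewrite -big_filter (bigD1_seq s) /=; last 2 first.
- by rewrite mem_filter fpowersetE fsubset_refl cs eqxx.
- by rewrite filter_uniq // fset_uniq.
have sv : size (vord K s) = p.+1 by rewrite size_vord.
rewrite (whitney_simplex_self t (face_affine HK fs) (vord_perm HK fs) sv).
rewrite big1_seq ?addr0 // => u /andP[us].
rewrite mem_filter fpowersetE => /andP[/eqP cu su].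
by case/negP: us; rewrite eqEfcard su cs cu leqnn.
Qed.

Lemma whitney_de_rham_whitney p (c : cochain R n) :
  whitney K p (de_rham K (whitney K p c)) = whitney K p c.
Proof.
apply/funext => T; apply/funext => x; apply/funext => M.
by apply: eq_fsbigr => s /set_mem Ks; rewrite de_rham_whitney.
Qed.

Lemma d_whitney_whitney p (c : cochain R n) :
  d_whitney K (whitney K p c) = whitney K p.+1 (coboundary K p c).
Proof.
rewrite /d_whitney; congr (whitney K p.+1 _); apply/funext => u.
by apply: eq_fsbigr => s /set_mem Ks; rewrite de_rham_whitney.
Qed.

End DeRham.

(** * The exterior derivative of Whitney forms, and the theorem *)

Section WhitneyForms.
Variables (R : realType) (n : nat) (K : oriented_complex R n).
Hypothesis HK : is_oriented_complex K.
Local Notation V := 'rV[R]_n.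
Variables (T : {fset V}) (al : V -> R) (l : V -> 'cV[R]_n).
Hypotheses (fT : faces K T) (Hal : bary_affine_spec T al l).

Definition bary_offsets p (s : seq V) : 'rV[R]_(1 + p) := \row_i al (nth 0 s i).
Definition bary_gradients p (s : seq V) : 'M[R]_(n, 1 + p) :=
  \matrix_(k, i) l (nth 0 s i) k 0.

Lemma whitney_simplex_det_form p s (x : V) (M : 'M[R]_(p, n)) :
  whitney_simplex s T x M =
  p`!%:R * det_form (bary_offsets p s) (bary_gradients p s) x M.
Proof.
rewrite whitney_simplexE /det_form -[in RHS]det_tr; congr (_ * \det _).
apply/row_matrixP => i; rewrite rowK tr_col_mx row_row_mx.
rewrite (whitney_row_affine _ _ _ Hal); congr row_mx.
  apply/matrixP => k j; rewrite !ord1 !mxE eqxx mulr1n; congr (_ + _).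
  by apply: eq_bigr => m _; rewrite !mxE.
apply/rowP => j; rewrite !mxE; apply: eq_bigr => m _.
by rewrite !mxE.
Qed.

Let subfaces p := [seq s <- fpowerset T | #|` s| == p.+1].

Lemma whitney_det_forms p (c : cochain R n) :
  whitney K p c T = fun (x : V) (M : 'M[R]_(p, n)) =>
  \sum_(s <- subfaces p) c s * p`!%:R *
    det_form (bary_offsets p (vord K s)) (bary_gradients p (vord K s)) x M.
Proof.
apply/funext => x; apply/funext => M; rewrite (whitney_faces HK) // big_filter.
by apply: eq_bigr => s _; rewrite whitney_simplex_det_form mulrA.
Qed.

Lemma ext_d_whitney p (c : cochain R n) :
  ext_d (whitney K p c T) = whitney K p.+1 (coboundary K p c) T.
Proof.
apply/funext => x; apply/funext => M.
rewrite whitney_det_forms ext_d_det_forms (whitney_coboundary HK) // big_filter.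
apply: eq_bigr => t _; rewrite (sum_whitney_cons _ _ _ Hal) -mulrA; congr (_ * _).
by rewrite mulrA -natrM mulnC -factS.
Qed.

(** Only the vertices of T have a coordinate that does not vanish on T. *)
Lemma discrete_field_affine (X : pw_field R n) : discrete_field K X ->
  exists b A, X T = fun x : V => b + x *m A.
Proof.
case=> c [_ XE]; exists (\sum_(i <- T) al i *: derive1 (c i) 0).
exists (\sum_(i <- T) l i *m derive1 (c i) 0); apply/funext => x.
rewrite XE // (fsbigE (enum_fset T)) //.
- rewrite mulmx_sumr -big_split big_mkcond big_seq [RHS]big_seq /=.
  apply: eq_bigr => i iT; rewrite ifT; last first.
    apply/mem_set/(face_closed HK fT); first by rewrite fsub1set.
    by apply/fset0Pn; exists i; rewrite inE.
  rewrite (bary_affineE Hal) scalerDl mulmxA; congr (_ + _).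
  by rewrite [x *m l i]mx11_scalar mul_scalar_mx mxE eqxx.
- move=> i /= iT; apply/(face_closed HK fT); first by rewrite fsub1set.
  by apply/fset0Pn; exists i; rewrite inE.
- by move=> i _ iT; rewrite bary_notin // scale0r.
Qed.

End WhitneyForms.

Theorem theorem1 (R : realType) (n p : nat) (Om : set 'rV[R]_n)
    (K : oriented_complex R n) (X : pw_field R n) (w : pw_form R n p) :
  manifold_with_boundary Om ->
  is_oriented_complex K ->
  triangulates K Om ->
  discrete_field K X ->
  (p <= n)%N ->
  range (whitney K p) w ->
  forall T : {fset 'rV[R]_n}, simplices K n T ->
  forall x : 'rV[R]_n, hull T x ->
  forall M : 'M[R]_(p, n),
    lie_derivative (X T) (whitney K p (de_rham K w) T) x M =
    interior_prod (X T) (d_whitney K w T) x M +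
    d_interior_prod (X T) (whitney K p (de_rham K w) T) x M.
Proof.
move=> _ HK _ HX _ [c _ <-] T [fT cT] x _ M.
have [al [l Hal]] := bary_affine (face_affine HK fT) cT.
have [b [A ->]] := discrete_field_affine HK fT Hal HX.
rewrite (whitney_de_rham_whitney HK) (d_whitney_whitney HK).
rewrite -(ext_d_whitney HK fT Hal).
apply: cartan_det_forms => y N.
by rewrite (whitney_det_forms HK fT Hal).
Qed.
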